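(* Let $\mathcal{A}=\{A_1,\ldots,A_n\}$ be a finite family of real $2\times 2$ Vandergraft matrices sharing the same dominant eigenvector $u$, i.e. $u\neq 0$ and $A_ju=\rho(A_j)u$ for $j=1,\ldots,n$. Then there exists an $\mathcal{A}$-invariant proper cone $\mathcal{K}\subset\mathbb{R}^2$ if and only if at least one of the following holds: (i) all $A_j$ are diagonalizable, and those of them (if any) which have $\det A_j<0$ and $\operatorname{trace}A_j=0$ are scalar multiples of each other; or (ii) all $A_j$ have non-negative determinants, and those of them which are not diagonalizable (if any) have the same orientation.
   Context: All matrices are real. A set $\mathcal{K}\subseteq\mathbb{R}^n$ is a cone if $a\mathcal{K}\subseteq\mathcal{K}$ for all $a\ge 0$; a cone is proper if $\mathcal{K}+\mathcal{K}\subseteq\mathcal{K}$ (convex), it is closed, pointed ($\mathcal{K}\cap-\mathcal{K}=\{0\}$) and solid (nonempty interior). $\mathcal{K}$ is $A$-invariant if $Ax\in\mathcal{K}$ for all $x\in\mathcal{K}$, and $\mathcal{A}$-invariant if it is $A$-invariant for every $A\in\mathcal{A}$. A real $n\times n$ matrix $A$ is a Vandergraft matrix if (1) its spectral radius $\rho(A)$ is an eigenvalue of $A$, and (2) $\deg\rho(A)\ge\deg\lambda$ for every eigenvalue $\lambda$ of $A$ with $|\lambda|=\rho(A)$, where $\deg\lambda$ is the multiplicity of $\lambda$ as a root of the minimal polynomial of $A$. A dominant eigenvector of such $A$ is an eigenvector corresponding to $\rho(A)$. If $A\in\mathbb{R}^{2\times2}$ is a non-diagonalizable Vandergraft matrix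 with (only) eigenvalue $\lambda$ and eigenvector $u$, then every $v\in\mathbb{R}^2$ satisfies $Av=\lambda v+xu$ for a unique $x\in\mathbb{R}$; $v$ is positively (negatively) associated with $u$ relative to $A$ if $x>0$ ($x<0$). Non-diagonalizable matrices sharing the eigenvector $u$ have the same orientation if the sets of vectors positively associated with $u$ relative to these matrices coincide. *)

(* Defs.v *)
From mathcomp Require Import all_boot all_order all_algebra.
From mathcomp Require Import complex.
From mathcomp Require Import all_classical all_reals all_analysis.

Set Implicit Arguments.
Unset Strict Implicit.
Unset Printing Implicit Defensive.

Import Order.TTheory GRing.Theory Num.Theory.
Import numFieldNormedType.Exports.

Local Open Scope classical_set_scope.
Local Open Scope ring_scope.
Local Open Scope complex_scope.

Definition complex_mx (R : realType) (n : nat) (A : 'M[R]_n) : 'M[R[i]]_n :=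
  map_mx (real_complex R) A.

(* [eigenvalue] refers to row eigenvectors; a square matrix has the same
   eigenvalues for row and for column vectors. *)
Definition spectral_radius (R : realType) (n : nat) (A : 'M[R]_n) : R :=
  sup [set r : R | exists2 l : R[i],
    eigenvalue (complex_mx A) l & `|l| = r%:C].

Definition eig_deg (R : realType) (n : nat) (A : 'M[R]_n.+1) (l : R[i]) : nat :=
  mup l (map_poly (real_complex R) (mxminpoly A)).

Definition vandergraft (R : realType) (n : nat) (A : 'M[R]_n.+1) : Prop :=
  eigenvalue A (spectral_radius A) /\
  forall l : R[i], eigenvalue (complex_mx A) l ->
    `|l| = (spectral_radius A)%:C ->
    (eig_deg A l <= eig_deg A (spectral_radius A)%:C)%N.

Definition is_cone (R : realType) (n : nat) (K : set 'cV[R]_n) : Prop :=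
  forall (a : R) (x : 'cV[R]_n), 0 <= a -> K x -> K (a *: x).

Definition proper_cone (R : realType) (n : nat) (K : set 'cV[R]_n) : Prop :=
  [/\ is_cone K,
      (forall x y : 'cV[R]_n, K x -> K y -> K (x + y)),
      closed K,
      K `&` [set - x | x in K] = [set 0] &
      interior K !=set0].

Definition mx_invariant (R : realType) (n : nat) (A : 'M[R]_n)
    (K : set 'cV[R]_n) : Prop :=
  forall x : 'cV[R]_n, K x -> K (A *m x).

(* Meant for non-diagonalizable Vandergraft [A], which has exactly one
   eigenvalue. *)
Definition pos_associated (R : realType) (A : 'M[R]_2) (u v : 'cV[R]_2) : Prop :=
  exists l x : R, [/\ eigenvalue A l, A *m v = l *: v + x *: u & 0 < x].

Definition same_orientation (R : realType) (u : 'cV[R]_2) (A B : 'M[R]_2) : Prop :=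
  [set v | pos_associated A u v] = [set v | pos_associated B u v].

(* Main.v *)
(** Choose coordinates (s, t) in which u is the first basis vector. Each A_j
    becomes upper triangular with diagonal (r_j, d_j), where r_j is its spectral
    radius and |d_j| <= r_j, and off-diagonal entry b_j.

    If d_j = r_j, the orbit of a vector of the cone with t <> 0 tends to the
    direction of b_j t u (or reaches it, if r_j = 0), so b_j t u lies in the
    closed cone. By pointedness the sign of b_j t is then constant on the cone,
    which forces equal orientations and excludes d_k < 0. Two non-proportional
    matrices with d_j = - r_j have a product of this shearing type, and applying
    A_j flips the sign of t: again a contradiction.

    Conversely, s >= C |t| (in the first case, after a shear that makes the
    matrices with d_j = - r_j diagonal) or t >= 0, s >= C t (in the second case,
    after choosing the sign of t) defines an invariant cone as soon as C
    dominates all |b_j| / (r_j - |d_j|) with |d_j| < r_j. *)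
Require Import Defs.
From mathcomp Require Import all_boot all_order all_algebra.
From mathcomp Require Import all_classical all_reals all_analysis.
From mathcomp Require Import complex ring lra.
Import Order.TTheory GRing.Theory Num.Theory.
Import numFieldNormedType.Exports.
Local Open Scope classical_set_scope.
Local Open Scope ring_scope.

Set Implicit Arguments.
Unset Strict Implicit.
Unset Printing Implicit Defensive.

(** * Algebra of 2 by 2 and upper triangular matrices *)

Lemma ord2P (i : 'I_2) : i = 0 \/ i = 1.
Proof. by case: i => [[|[|i]] lti] //; [left|right]; apply: val_inj. Qed.

Lemma big_ord2 (V : nmodType) (f : 'I_2 -> V) : \sum_i f i = f 0 + f 1.
Proof.
by rewrite !big_ord_recl big_ord0 addr0; congr (f _ + f _); apply: val_inj.
Qed.

Lemma mulmx2E (K : comNzRingType) (p : nat) (M : 'M[K]_2) (N : 'M[K]_(2, p)) i j :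
  (M *m N) i j = M i 0 * N 0 j + M i 1 * N 1 j.
Proof. by rewrite mxE big_ord2. Qed.

Lemma det2E (K : comNzRingType) (M : 'M[K]_2) :
  \det M = M 0 0 * M 1 1 - M 0 1 * M 1 0.
Proof.
have l0 : lift (0 : 'I_2) (0 : 'I_1) = 1 by apply: val_inj.
have l1 : lift (1 : 'I_2) (0 : 'I_1) = 0 by apply: val_inj.
rewrite (expand_det_row _ 0) big_ord2 /cofactor !det_mx11 !mxE l0 l1 /=.
by rewrite expr0 expr1 mul1r mulN1r mulrN.
Qed.

Definition utri {K : nzRingType} (r b d : K) : 'M[K]_2 :=
  \matrix_(i, j) if j == 0 then if i == 0 then r else 0
                 else if i == 0 then b else d.

Lemma det_utri (K : comNzRingType) (r b d : K) : \det (utri r b d) = r * d.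
Proof. by rewrite det2E !mxE /= mulr0 subr0. Qed.

Lemma tr_utri (K : nzRingType) (r b d : K) : \tr (utri r b d) = r + d.
Proof. by rewrite /mxtrace big_ord2 !mxE. Qed.

Lemma mul_utri (K : comNzRingType) (r b d r' b' d' : K) :
  utri r b d *m utri r' b' d' = utri (r * r') (r * b' + b * d') (d * d').
Proof.
apply/matrixP=> i j; rewrite mulmx2E.
case: (ord2P i) => ->; case: (ord2P j) => ->; rewrite !mxE /=; ring.
Qed.

Lemma utri_inj (K : nzRingType) (r b d r' b' d' : K) :
  utri r b d = utri r' b' d' -> [/\ r = r', b = b' & d = d'].
Proof.
move=> /matrixP e; have := (e 0 0, e 0 1, e 1 1).
by rewrite !mxE /= => -[[-> ->] ->].
Qed.

Lemma mul_utri_sub (K : comNzRingType) (r b d : K) :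
  (utri r b d - r%:M) *m (utri r b d - d%:M) = 0.
Proof.
apply/matrixP=> i j; rewrite mulmx2E.
case: (ord2P i) => ->; case: (ord2P j) => ->; rewrite !mxE /=; ring.
Qed.

Lemma scalar_utri (K : nzRingType) (r : K) : r%:M = utri r 0 r.
Proof.
by apply/matrixP=> i j; case: (ord2P i) => ->; case: (ord2P j) => ->; rewrite !mxE.
Qed.

(** * Eigenvalues and diagonalizability through a triangular form *)

Lemma eigenvalue_quadratic (K : fieldType) (n : nat) (M : 'M[K]_n) (a b l : K) :
  (M - a%:M) *m (M - b%:M) = 0 -> eigenvalue M l -> l = a \/ l = b.
Proof.
move=> M0 /eigenvalueP[v vM v0].
have shift c : v *m (M - c%:M) = (l - c) *: v.
  by rewrite mulmxBr vM mul_mx_scalar scalerBl.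
have : v *m ((M - a%:M) *m (M - b%:M)) = 0 by rewrite M0 mulmx0.
rewrite mulmxA shift -scalemxAl shift scalerA => /eqP.
rewrite scaler_eq0 (negPf v0) orbF mulf_eq0 !subr_eq0.
by case/orP=> /eqP; [left|right].
Qed.

(* [F *m A = utri r b d *m F] says that in the coordinates [F] the matrix [A]
   is upper triangular, the first coordinate axis being spanned by the common
   dominant eigenvector. *)
Lemma triangularize (K : fieldType) (F A : 'M[K]_2) (u : 'cV[K]_2) (r : K) :
    F \in unitmx -> F *m u = delta_mx 0 0 -> A *m u = r *: u ->
  exists bd, F *m A = utri r bd.1 bd.2 *m F.
Proof.
move=> Fu Fe Au; pose T := F *m A *m invmx F.
have Te : T *m (delta_mx 0 0 : 'cV_2) = r *: delta_mx 0 0.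
  by rewrite -Fe mulmxA mulmxKV// -mulmxA Au scalemxAr.
exists (T 0 1, T 1 1); rewrite -[LHS](mulmxKV Fu) -/T; congr (_ *m _).
have {Te} T0 i : T i 0 = r * (i == 0)%:R.
  by have := congr1 (fun M => fun_of_matrix M i 0) Te; rewrite -colE !mxE andbT.
apply/matrixP=> i j; case: (ord2P i) => ->; case: (ord2P j) => ->;
  by rewrite [RHS]mxE /= ?T0 ?mulr1 ?mulr0.
Qed.

Lemma frame_exists (R : realFieldType) (u : 'cV[R]_2) : u != 0 ->
  exists2 F : 'M[R]_2, F \in unitmx & F *m u = delta_mx 0 0.
Proof.
move=> u0; pose N := u 0 0 ^+ 2 + u 1 0 ^+ 2.
have N0 : N != 0.
  apply: contraNneq u0 => /eqP.
  rewrite paddr_eq0 ?sqr_ge0// !expf_eq0 /= => /andP[/eqP a0 /eqP b0].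
  by apply/eqP/matrixP=> i j; rewrite (ord1 j) mxE; case: (ord2P i) => ->.
(* The rows are [u / N] and [u] turned by a right angle, so the second kills [u] and the determinant
   is 1. *)
exists (\matrix_(i, j) if i == 0 then u j 0 / N
                       else if j == 0 then - u 1 0 else u 0 0).
  rewrite unitmxE det2E !mxE /= (_ : _ - _ = 1) ?unitr1//.
  by rewrite /N in N0 *; field.
apply/matrixP=> i j; rewrite (ord1 j) mulmx2E.
case: (ord2P i) => ->; rewrite !mxE /=; last by ring.
by rewrite /N in N0 *; field.
Qed.

Lemma tri_simE (K : fieldType) (F A : 'M[K]_2) (r b d : K) :
  F \in unitmx -> F *m A = utri r b d *m F -> A = invmx F *m utri r b d *m F.
Proof. by move=> Fu FA; rewrite -mulmxA -FA mulKmx. Qed.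

Lemma tri_det (K : fieldType) (F A : 'M[K]_2) (r b d : K) :
  F \in unitmx -> F *m A = utri r b d *m F -> \det A = r * d.
Proof.
move=> Fu /(tri_simE Fu) ->.
by rewrite det_mulmx mulrC -det_mulmx mulmxA mulmxV// mul1mx det_utri.
Qed.

Lemma tri_tr (K : fieldType) (F A : 'M[K]_2) (r b d : K) :
  F \in unitmx -> F *m A = utri r b d *m F -> \tr A = r + d.
Proof.
move=> Fu /(tri_simE Fu) ->.
by rewrite -mulmxA mxtrace_mulC mulmxK// tr_utri.
Qed.

Lemma tri_eigenvalue (K : fieldType) (F A : 'M[K]_2) (r b d : K) :
  F \in unitmx -> F *m A = utri r b d *m F -> eigenvalue A d.
Proof.
(* The second row of [utri r b d] is [(0, d)], so the second row of [F] is a row eigenvector. *)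
move=> Fu FA; apply/eigenvalueP; exists (row 1 F).
  rewrite -row_mul FA; apply/rowP=> j.
  by rewrite mxE mulmx2E !mxE /= mul0r add0r.
apply: contraTneq Fu => F1; rewrite unitmxE det2E.
have F10 j : F 1 j = 0 by move/rowP: F1 => /(_ j); rewrite !mxE.
by rewrite !F10 !mulr0 subr0 unitr0.
Qed.

Lemma tri_quadratic (K : fieldType) (F A : 'M[K]_2) (r b d : K) :
    F \in unitmx -> F *m A = utri r b d *m F ->
  (A - r%:M) *m (A - d%:M) = 0.
Proof.
move=> Fu FA; apply: (can_inj (mulKmx Fu)); rewrite mulmx0 mulmxA.
have shift c : F *m (A - c%:M) = (utri r b d - c%:M) *m F.
  by rewrite mulmxBr mulmxBl FA scalar_mxC.
by rewrite shift -mulmxA shift mulmxA mul_utri_sub mul0mx.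
Qed.

(** The minimal polynomial divides [(X - r)(X - d)], which has simple roots. *)
Lemma tri_diag_neq (K : fieldType) (F A : 'M[K]_2) (r b d : K) :
    F \in unitmx -> F *m A = utri r b d *m F -> r != d -> diagonalizable A.
Proof.
move=> Fu FA rd; apply/diagonalizableP; exists [:: r; d].
  by rewrite /= inE rd.
apply: mxminpoly_min; rewrite !big_cons big_nil mulr1 rmorphM /=.
rewrite !rmorphB /= horner_mx_X !horner_mx_C.
exact: (tri_quadratic Fu FA).
Qed.

Lemma tri_diag0 (K : fieldType) (F A : 'M[K]_2) (r d : K) :
    F \in unitmx -> F *m A = utri r 0 d *m F -> diagonalizable A.
Proof.
move=> Fu FA; have [rd|] := eqVneq r d; last exact: tri_diag_neq FA.
rewrite -rd -scalar_utri -scalar_mxC in FA.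
by rewrite (can_inj (mulKmx Fu) FA); apply: diagonalizable_scalar.
Qed.

(** After diagonalization, [A - r] becomes a diagonal matrix [E] of square zero, hence zero. *)
Lemma diagonalizable_sqr0 (K : fieldType) (n : nat) (A : 'M[K]_n.+1) (r : K) :
  diagonalizable A -> (A - r%:M) *m (A - r%:M) = 0 -> A = r%:M.
Proof.
case=> P Pu /(similar_diagLR Pu)[D ->]; rewrite conjVmx//.
set B := _ *m _ *m _ => B0; pose E := D - const_mx r.
have BE : B - r%:M = invmx P *m diag_mx E *m P.
  rewrite raddfB /= diag_const_mx mulmxBr mulmxBl; congr (_ - _).
  by rewrite scalar_mxC mulmxKV.
have EE : diag_mx E *m diag_mx E = P *m ((B - r%:M) *m (B - r%:M)) *m invmx P.
  by rewrite BE !mulmxA mulmxV// mul1mx !mulmxK.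
rewrite B0 mulmx0 mul0mx mulmx_diag in EE.
suff E0 : E = 0.
  by apply/eqP; rewrite -subr_eq0 BE E0 raddf0 mulmx0 mul0mx.
apply/rowP=> i; have := congr1 (fun M => fun_of_matrix M i i) EE.
by rewrite !mxE eqxx mulr1n => /eqP; rewrite mulf_eq0 orbb => /eqP.
Qed.

Lemma tri_diag_eq (K : fieldType) (F A : 'M[K]_2) (r b : K) :
    F \in unitmx -> F *m A = utri r b r *m F -> diagonalizable A -> b = 0.
Proof.
move=> Fu FA /diagonalizable_sqr0 /(_ (tri_quadratic Fu FA)) A_r.
move: FA; rewrite A_r scalar_mxC scalar_utri => /(can_inj (mulmxK Fu)).
by case/utri_inj.
Qed.

Lemma tri_spectral_radius (R : realType) (F A : 'M[R]_2) (r b d : R) :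
    F \in unitmx -> F *m A = utri r b d *m F -> `|d| <= spectral_radius A.
Proof.
move=> Fu FA; rewrite /spectral_radius.
set S := [set _ | _]; apply: (@ub_le_sup _ S).
  (* [sup] is an upper bound only of a set bounded above: the complex eigenvalues, too, are among
     [r] and [d]. *)
  exists (`|r| + `|d|) => x [l].
  have quad : (complex_mx A - (r%:C)%C%:M) *m (complex_mx A - (d%:C)%C%:M) = 0.
    have := congr1 (map_mx (real_complex R)) (tri_quadratic Fu FA).
    by rewrite map_mxM !map_mxB !map_scalar_mx map_mx0.
  by case/(eigenvalue_quadratic quad) => ->;
    rewrite normc_def /= expr0n addr0 sqrtr_sqr => -[<-];
    rewrite ?lerDl ?lerDr normr_ge0.
exists (d%:C)%C; last by rewrite normc_def /= expr0n addr0 sqrtr_sqr.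
by rewrite eigenvalue_map (tri_eigenvalue Fu FA).
Qed.

(** * Construction of invariant proper cones *)

Lemma coord_mulmx_continuous (R : realType) (m n : nat) (P : 'M[R]_(m, n)) i j :
  continuous (fun v : 'cV[R]_n => (P *m v) i j).
Proof.
rewrite (_ : (fun _ => _) =
    (fun v : 'cV[R]_n => \sum_k P i k * v k j)); last first.
  by apply/funext=> v; rewrite mxE.
apply: continuous_big => [|k _ v]; first exact: add_continuous.
by apply: continuousM; [exact: cst_continuous|exact: coord_continuous].
Qed.

Lemma proper_cone_preimage_orthant (R : realType) (n : nat) (P : 'M[R]_n) :
  P \in unitmx -> proper_cone [set v : 'cV[R]_n | forall i, 0 <= (P *m v) i 0].
Proof.
move=> Pu; split.
- by move=> a x a0 x0 i; rewrite -scalemxAr mxE mulr_ge0.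
- by move=> x y x0 y0 i; rewrite mulmxDr mxE addr_ge0.
- rewrite (_ : [set v | _] =
      \bigcap_i ((fun v : 'cV[R]_n => (P *m v) i 0) @^-1` [set x | 0 <= x])).
    apply: (@closed_bigI) => i _; apply: (@preimage_closed); last exact: closed_ge.
    by move=> v _; exact: coord_mulmx_continuous.
  by apply/seteqP; split=> [v v0 i _|v v0 i]; apply: v0.
- apply/seteqP; split=> [y [y0 [x x0 xy]]|_ ->]; last first.
    have z0 : forall i, 0 <= (P *m (0 : 'cV[R]_n)) i 0 by move=> i; rewrite mulmx0 mxE.
    by split=> //; exists 0; rewrite ?oppr0.
  move: y0; rewrite -xy => xN0.
  apply/eqP; rewrite oppr_eq0; apply/eqP/(can_inj (mulKmx Pu)); rewrite mulmx0.
  apply/colP=> i; rewrite [RHS]mxE; apply/eqP; rewrite eq_le x0 andbT.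
  by have := xN0 i; rewrite mulmxN mxE oppr_ge0.
(* All coordinates of [P *m w] equal 1, so they stay positive near [w]. *)
- pose w : 'cV[R]_n := invmx P *m const_mx 1; exists w.
  apply: (@filter_forall _ _ (fun i v => 0 <= (P *m v) i 0) (nbhs w)
    (nbhs_filter w)) => i.
  have : nbhs ((P *m w) i 0) [set x : R | 0 < x].
    by rewrite mulKVmx// mxE; apply: lt_nbhsr.
  move=> /coord_mulmx_continuous.
  by apply: (@filterS _ (nbhs w) (nbhs_filter w)) => v /= /ltW.
Qed.

Lemma dominating_slope (R : realFieldType) (n : nat) (b e : 'I_n -> R) :
  (forall j, 0 <= e j) ->
  exists2 C, 0 < C & forall j, e j != 0 -> `|b j| <= C * e j.
Proof.
move=> e0; pose q j := `|b j| / e j.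
have q0 j : 0 <= q j by rewrite divr_ge0.
(* The sum dominates each quotient (those with [e j = 0] are 0 by convention); the 1 ensures
   positivity. *)
exists (1 + \sum_j q j); first by rewrite ltr_pwDl// sumr_ge0.
move=> j ej; rewrite -ler_pdivrMr ?lt_def ?ej ?e0//.
by rewrite (bigD1 j)//= addrCA lerDl addr_ge0 ?sumr_ge0.
Qed.

(** The rows encode [s + C t >= 0] and [s - C t >= 0], that is, [s >= C |t|]. *)
Definition wedge_mx {R : realType} (C : R) : 'M[R]_2 :=
  \matrix_(i, j) if j == 0 then 1 else if i == 0 then C else - C.

(** The image of [(s, t)] is [(r s + b t, d t)], and [r s + b t >= (r C - |b|) |t| >= C |d t|]. *)
Lemma wedge_invariant (R : realType) (F A : 'M[R]_2) (r b d C : R) :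
    0 < C -> F *m A = utri r b d *m F -> `|d| <= r -> `|b| <= C * (r - `|d|) ->
  mx_invariant A [set v | forall i, 0 <= (wedge_mx C *m F *m v) i 0].
Proof.
move=> C0 FA dr bC v v0 i; move: (v0 0) (v0 1).
rewrite -!mulmxA [in F *m (A *m v)]mulmxA FA -!mulmxA; move: (F *m v) => x.
rewrite !mulmx2E !mxE /= => x0 x1.
have xC : C * `|x 1 0| <= x 0 0 by case: ler0P => _; lra.
have r0 : 0 <= r by exact: le_trans dr.
have bx : - (`|b| * `|x 1 0|) <= b * x 1 0 by rewrite -normrM lerNnormlW.
have rx : r * (C * `|x 1 0|) <= r * x 0 0 by rewrite ler_wpM2l.
have bCx : `|b| * `|x 1 0| <= C * (r - `|d|) * `|x 1 0| by rewrite ler_wpM2r.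
have dx : `|C * (d * x 1 0)| <= C * (`|d| * `|x 1 0|).
  by rewrite !normrM gtr0_norm.
move: dx; rewrite ler_norml => /andP[dx1 dx2].
by case: (ord2P i) => -> /=; lra.
Qed.

(** If [t >= 0] and [s >= C t], then [d t >= 0] and [r s + b t >= (r C + b) t >= C d t]. *)
Lemma halfplane_wedge_invariant (R : realType) (F A : 'M[R]_2) (r b d C : R) :
    F *m A = utri r b d *m F -> 0 <= d <= r -> - b <= C * (r - d) ->
  mx_invariant A [set v | forall i, 0 <= (utri 1 (- C) 1 *m F *m v) i 0].
Proof.
move=> FA /andP[d0 dr] bC v v0 i; move: (v0 0) (v0 1).
rewrite -!mulmxA [in F *m (A *m v)]mulmxA FA -!mulmxA; move: (F *m v) => x.
rewrite !mulmx2E !mxE /= => x0 x1.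
have r0 : 0 <= r by exact: le_trans dr.
case: (ord2P i) => -> /=; nra.
Qed.

Lemma cone_of_diagonalizable (R : realType) (n : nat) (A : 'I_n -> 'M[R]_2)
    (F : 'M[R]_2) (r b d : 'I_n -> R) :
    F \in unitmx -> (forall j, F *m A j = utri (r j) (b j) (d j) *m F) ->
    (forall j, `|d j| <= r j) -> (forall j, `|d j| = r j -> b j = 0) ->
  exists K, proper_cone K /\ forall j, mx_invariant (A j) K.
Proof.
move=> Fu FA dr br.
have [j|C C0 CP] := @dominating_slope _ _ b (fun j => r j - `|d j|).
  by rewrite subr_ge0.
exists [set v | forall i, 0 <= (wedge_mx C *m F *m v) i 0]; split.
  apply: proper_cone_preimage_orthant; rewrite unitmx_mul Fu andbT.
  by rewrite unitmxE det2E !mxE /= unitfE; lra.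
move=> j; apply: wedge_invariant (FA j) (dr j) _ => //.
have [e0|/CP//] := eqVneq (r j - `|d j|) 0.
by rewrite br ?normr0 ?e0 ?mulr0//; move/eqP: e0; rewrite subr_eq0 => /eqP.
Qed.

Lemma cone_of_nonneg_det (R : realType) (n : nat) (A : 'I_n -> 'M[R]_2)
    (F : 'M[R]_2) (r b d : 'I_n -> R) :
    F \in unitmx -> (forall j, F *m A j = utri (r j) (b j) (d j) *m F) ->
    (forall j, 0 <= d j <= r j) -> (forall j, d j = r j -> 0 <= b j) ->
  exists K, proper_cone K /\ forall j, mx_invariant (A j) K.
Proof.
move=> Fu FA dr br.
have [j|C C0 CP] := @dominating_slope _ _ b (fun j => r j - d j).
  by rewrite subr_ge0; case/andP: (dr j).
exists [set v | forall i, 0 <= (utri 1 (- C) 1 *m F *m v) i 0]; split.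
  apply: proper_cone_preimage_orthant; rewrite unitmx_mul Fu andbT.
  by rewrite unitmxE det_utri mulr1 unitr1.
move=> j; apply: halfplane_wedge_invariant (FA j) (dr j) _.
have [e0|/CP] := eqVneq (r j - d j) 0.
  by rewrite e0 mulr0 oppr_le0 br//; move/eqP: e0; rewrite subr_eq0 => /eqP.
by apply: le_trans; rewrite -normrN ler_norm.
Qed.

(** Passing to coordinates [(s + c t, e t)]: [c] serves to cancel an off-diagonal entry, [e = -1] to
    flip the signs of all of them. *)
Lemma change_frame (K : fieldType) (F A : 'M[K]_2) (r b d c e : K) :
    e != 0 -> F *m A = utri r b d *m F ->
  utri 1 c e *m F *m A =
    utri r ((b + c * (d - r)) / e) d *m (utri 1 c e *m F).
Proof.
move=> e0 FA; rewrite -mulmxA FA !mulmxA !mul_utri; congr (utri _ _ _ *m F).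
- by rewrite mulrC.
- by field.
- by rewrite mulrC.
Qed.

(** * Constraints imposed by an invariant proper cone *)

(** The points [x / (k + 1) + y] are rescaled points of [K] and tend to [y]. *)
Lemma closed_cone_direction (R : realType) (n : nat) (K : set 'cV[R]_n.+1)
    (x y : 'cV[R]_n.+1) : is_cone K -> closed K ->
  (forall k : nat, K (x + k%:R *: y)) -> K y.
Proof.
move=> Kcone Kclosed Kxy.
have cvy : (fun k => harmonic k *: x + y) @ \oo --> y.
  rewrite -[X in _ --> X]add0r -(scale0r x).
  apply: cvgD; last exact: cvg_cst.
  by apply: cvgZ; [exact: cvg_harmonic|exact: cvg_cst].
apply: (closed_cvg _ Kclosed _ _ cvy).
apply: nearW => k; rewrite (_ : _ + _ = k.+1%:R^-1 *: (x + k.+1%:R *: y)).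
  by apply: Kcone (Kxy _); rewrite invr_ge0.
by rewrite scalerDr scalerA mulVf ?scale1r// pnatr_eq0.
Qed.

(** A hyperplane has empty interior: an interior point lying on it is pushed off along [w]. *)
Lemma solid_off_axis (R : realType) (n : nat) (K : set 'cV[R]_n.+1)
    (F : 'M[R]_n.+1) (i : 'I_n.+1) : F \in unitmx -> interior K !=set0 ->
  exists2 v, K v & (F *m v) i 0 != 0.
Proof.
move=> Fu [x Kx]; have [Fx0|Fx] := eqVneq ((F *m x) i 0) 0; last first.
  by exists x => //; apply: interior_subset.
pose w : 'cV[R]_n.+1 := invmx F *m delta_mx i 0.
have cvx : (fun e : R => x + e *: w) @ (0 : R) --> x.
  rewrite -[X in _ --> X]addr0 -(scale0r w).
  by apply: cvgD; [exact: cvg_cst|apply: cvgZ; [exact: cvg_id|exact: cvg_cst]].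
have [e [e0 Ke]] : exists e : R, e != 0 /\ K (x + e *: w).
  apply: (@filter_ex _ ((0 : R)^')); near=> e; split.
    by near: e; exact: nbhs_dnbhs_neq.
  by near: e; apply: nbhs_dnbhs; exact: (cvx K Kx).
exists (x + e *: w) => //.
by rewrite mulmxDr mxE Fx0 add0r -scalemxAr /w mulKVmx// !mxE !eqxx mulr1.
Unshelve. all: by end_near. Qed.

(** For [v] with coordinates [(s, t)], [A *m v] is [r *: v + (b t) *: u], and [r] is the only
    eigenvalue. *)
Lemma pos_associatedE (R : realType) (F A : 'M[R]_2) (u v : 'cV[R]_2) (r b : R) :
    F \in unitmx -> F *m u = delta_mx 0 0 -> F *m A = utri r b r *m F ->
  pos_associated A u v <-> 0 < b * (F *m v) 1 0.
Proof.
move=> Fu Fe FA.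
have Av x : A *m v = r *: v + x *: u <-> x = b * (F *m v) 1 0.
  have FAv : F *m (A *m v) = utri r b r *m (F *m v) by rewrite !mulmxA FA.
  split=> [Avx|->].
    have := congr1 (fun w => (F *m w) 0 0) Avx.
    rewrite /= FAv mulmxDr -!scalemxAr Fe; move: (F *m v) => y.
    rewrite mulmx2E !mxE /= mulr1 => e; lra.
  apply: (can_inj (mulKmx Fu)); rewrite FAv mulmxDr -!scalemxAr Fe.
  move: (F *m v) => y; apply/colP=> i.
  by rewrite mulmx2E !mxE; case: (ord2P i) => -> /=; ring.
split=> [[l [x [Al Avx x0]]]|bv0].
  have lr : l = r.
    by have [] := eigenvalue_quadratic (tri_quadratic Fu FA) Al.
  by move: Avx; rewrite lr => /Av <-.
exists r, (b * (F *m v) 1 0); split=> //; first exact: tri_eigenvalue Fu FA.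
exact/Av.
Qed.

(* In the coordinates [F] the matrix acts as a shear, up to the factor [r],
   so the directions of the orbit of [v] tend to that of [u]. *)
Lemma shear_orbit_direction (R : realType) (K : set 'cV[R]_2) (F A : 'M[R]_2)
    (u v : 'cV[R]_2) (r b : R) :
    is_cone K -> closed K -> mx_invariant A K ->
    F \in unitmx -> F *m u = delta_mx 0 0 -> F *m A = utri r b r *m F ->
    A *m u = r *: u -> 0 <= r -> K v ->
  K ((b * (F *m v) 1 0) *: u).
Proof.
move=> Kcone Kclosed KA Fu Fe FA Au r0 Kv; set x := b * _.
have Av : A *m v = r *: v + x *: u.
  apply: (can_inj (mulKmx Fu)); rewrite mulmxA FA -mulmxA mulmxDr -!scalemxAr Fe.
  rewrite /x; move: (F *m v) => y; apply/colP=> i.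
  by rewrite mulmx2E !mxE; case: (ord2P i) => -> /=; ring.
move: r0; rewrite le_eqVlt => /predU1P[r0|r0].
  by have := KA _ Kv; rewrite Av -r0 scale0r add0r.
have -> : x *: u = r *: ((x / r) *: u).
  by rewrite scalerA mulrC divfK// gt_eqF.
apply: (Kcone _ _ (ltW r0)); apply: (@closed_cone_direction _ _ _ v _ Kcone Kclosed) => k.
(* With [y = (x / r) *: u], the map [A / r] sends [v + k y] to [v + (k + 1) y]. *)
elim: k => [|k IHk]; first by rewrite scale0r addr0.
have -> : v + k.+1%:R *: (x / r *: u) =
    r^-1 *: (A *m (v + k%:R *: (x / r *: u))).
  rewrite mulmxDr -!scalemxAr Av Au; apply/colP=> i; rewrite !mxE -natr1.
  by field; rewrite gt_eqF.
by apply: Kcone (KA _ IHk); rewrite invr_ge0 ltW.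
Qed.

(** If [x y < 0], then [y^2 x u] and its negative are nonnegative multiples of [x u] and [y u], so
    [K] contains a line. *)
Lemma pointed_same_sign (R : realType) (n : nat) (K : set 'cV[R]_n)
    (u : 'cV[R]_n) (x y : R) :
  proper_cone K -> u != 0 -> K (x *: u) -> K (y *: u) -> 0 <= x * y.
Proof.
case=> Kcone _ _ Kpointed _ u0 Kx Ky; rewrite leNgt; apply/negP => xy0.
have Kw : K ((y ^+ 2 * x) *: u) by rewrite -scalerA; apply: Kcone Kx; exact: sqr_ge0.
have KNw : K (- ((y ^+ 2 * x) *: u)).
  rewrite (_ : - _ = (- (x * y)) *: (y *: u)).
    by apply: Kcone Ky; rewrite oppr_ge0 ltW.
  by rewrite -scaleNr scalerA; congr (_ *: _); ring.
have : (K `&` [set - z | z in K]) ((y ^+ 2 * x) *: u).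
  by split=> //; exists (- ((y ^+ 2 * x) *: u)); rewrite ?opprK.
rewrite Kpointed => /eqP; rewrite scaler_eq0 (negPf u0) orbF.
by rewrite mulf_eq0 expf_eq0 /= => /orP[] /eqP z0;
  move: xy0; rewrite z0 ?mulr0 ?mul0r ltxx.
Qed.

Theorem theorem6 (R : realType) (n : nat) (A : 'I_n -> 'M[R]_2) (u : 'cV[R]_2)
    (hV : forall j : 'I_n, vandergraft (A j))
    (hu : u != 0)
    (hAu : forall j : 'I_n, A j *m u = spectral_radius (A j) *: u) :
  (exists K : set 'cV[R]_2,
      proper_cone K /\ forall j : 'I_n, mx_invariant (A j) K)
  <->
  (((forall j : 'I_n, diagonalizable (A j)) /\
    (forall j k : 'I_n,
        \det (A j) < 0 -> \tr (A j) = 0 ->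
        \det (A k) < 0 -> \tr (A k) = 0 ->
        exists c : R, A j = c *: A k))
   \/
   ((forall j : 'I_n, 0 <= \det (A j)) /\
    (forall j k : 'I_n,
        ~ diagonalizable (A j) -> ~ diagonalizable (A k) ->
        same_orientation u (A j) (A k)))).
Proof.
have [F Fu Fe] := frame_exists hu.
have /choice[bd FA] :
    forall j, exists x, F *m A j = utri (spectral_radius (A j)) x.1 x.2 *m F.
  by move=> j; apply: triangularize (hAu j).
pose r j := spectral_radius (A j); pose b j := (bd j).1; pose d j := (bd j).2.
have {}FA j : F *m A j = utri (r j) (b j) (d j) *m F by exact: FA.
have {}hAu j : A j *m u = r j *: u by exact: hAu.
have dr j : `|d j| <= r j by exact: tri_spectral_radius Fu (FA j).
have r0 j : 0 <= r j by exact: le_trans (dr j).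
have detA j : \det (A j) = r j * d j by exact: tri_det Fu (FA j).
have trA j : \tr (A j) = r j + d j by exact: tri_tr Fu (FA j).
move: {hV} r b d FA hAu dr r0 detA trA => r b d FA hAu dr r0 detA trA.
have drE j : ~ diagonalizable (A j) -> d j = r j.
  move=> Aj; apply/eqP; apply: contra_notT Aj => rd.
  by apply: tri_diag_neq Fu (FA j) _; rewrite eq_sym.
have b0 j : ~ diagonalizable (A j) -> b j != 0.
  move=> Aj; apply: contra_notN Aj => /eqP bj.
  by apply: tri_diag0 Fu _; rewrite FA bj.
(* These are the nonzero multiples of reflections, with eigenvalues [r j] and [- r j]. *)
have reflect j : \det (A j) < 0 -> \tr (A j) = 0 -> 0 < r j /\ d j = - r j.
  rewrite detA trA => rd /eqP; rewrite addr_eq0 => /eqP rE.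
  split; last by rewrite rE opprK.
  by rewrite lt_def r0 andbT; apply: contraTneq rd => ->; rewrite mul0r ltxx.
split; last first.

  (* Sufficiency of each condition *)
  case=> [[Adiag Ascal]|[Adet Aori]].
  - have [F' [b' [F'u F'A b'0]]] : exists F' b', [/\ F' \in unitmx,
        forall j, F' *m A j = utri (r j) (b' j) (d j) *m F'
      & forall j, \det (A j) < 0 -> \tr (A j) = 0 -> b' j = 0].
      have [[k [dk tk]]|nok] := pselect (exists k, \det (A k) < 0 /\ \tr (A k) = 0);
        last by exists F, b; split=> // j dj tj; case: nok; exists j.
      have [rk dkE] := reflect k dk tk.
      (* This [c] solves [b k + c (d k - r k) = 0] for [d k = - r k]; the other reflections, being
         multiples of [A k], become diagonal with it. *)
      pose c := b k / (2 * r k); pose b' j := (b j + c * (d j - r j)) / 1.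
      have F'u : utri 1 c 1 *m F \in unitmx.
        by rewrite unitmx_mul Fu unitmxE det_utri mulr1 unitr1.
      have F'A j : utri 1 c 1 *m F *m A j =
          utri (r j) (b' j) (d j) *m (utri 1 c 1 *m F).
        by apply: change_frame; rewrite ?oner_eq0.
      have b'k : b' k = 0 by rewrite /b' /c dkE; field; rewrite gt_eqF.
      exists (utri 1 c 1 *m F), b'; split=> // j dj tj.
      have [a Aj] := Ascal j k dj tj dk tk.
      have := F'A j; rewrite {1}Aj -scalemxAr F'A scalemxAl.
      move=> /(can_inj (mulmxK F'u)) /matrixP/(_ 0 1).
      by rewrite !mxE /= b'k mulr0.
    apply: (cone_of_diagonalizable F'u F'A dr) => j.
    (* If [|d j| = r j], then [A j] has a double eigenvalue (hence is scalar) or is a reflection up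
       to a factor. *)
    have [d0|d0] := ler0P (d j) => rE; last first.
      by apply: (@tri_diag_eq _ _ _ (r j) (b' j) F'u _ (Adiag j)); rewrite F'A rE.
    have [rj0|rj0] := eqVneq (r j) 0.
      have dj0 : d j = 0 by apply/eqP; rewrite -oppr_eq0 rE rj0.
      by apply: (@tri_diag_eq _ _ _ 0 (b' j) F'u _ (Adiag j)); rewrite F'A rj0 dj0.
    apply: b'0; rewrite ?detA ?trA -rE ?addNr// mulNr oppr_lt0 -expr2.
    by rewrite exprn_even_gt0//= -oppr_eq0 rE.
  - have [F' [b' [F'u F'A b'0]]] : exists F' b', [/\ F' \in unitmx,
        forall j, F' *m A j = utri (r j) (b' j) (d j) *m F'
      & forall j, ~ diagonalizable (A j) -> 0 <= b' j].
      have [[k [Ak bk]]|nok] := pselect (exists k, ~ diagonalizable (A k) /\ b k < 0);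
        last first.
        exists F, b; split=> // j Aj; rewrite leNgt; apply/negP => bj.
        by case: nok; exists j.
      pose b' j := (b j + 0 * (d j - r j)) / -1.
      exists (utri 1 0 (-1) *m F), b'; split.
      + by rewrite unitmx_mul Fu unitmxE det_utri mul1r unitrN1.
      + by move=> j; apply: change_frame; rewrite ?oppr_eq0 ?oner_eq0.
      (* As [v] has [t = -1], it is positively associated exactly when [b i < 0]; equal orientations
         carry this from [k] to [j]. *)
      move=> j Aj; pose v : 'cV[R]_2 := invmx F *m (- delta_mx 1 0).
      have Fv : (F *m v) 1 0 = -1 by rewrite mulKVmx// !mxE.
      have pos i : ~ diagonalizable (A i) -> pos_associated (A i) u v <-> b i < 0.
        move=> Ai; have := FA i; rewrite drE// => FAi.
        apply: iff_trans (pos_associatedE v Fu Fe FAi) _.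
        by rewrite Fv mulrN1 oppr_gt0.
      have bj : b j < 0.
        apply/(pos j Aj).
        have := Aori j k Aj Ak; rewrite /same_orientation => /seteqP[_]; apply.
        exact/(pos k Ak).
      by rewrite /b' mul0r addr0 invrN1 mulrN1 oppr_ge0 ltW.
    apply: (cone_of_nonneg_det F'u F'A) => j.
      have := Adet j; rewrite detA => rd0; have := dr j; rewrite ler_norml.
      case/andP=> dr1 dr2; rewrite dr2 andbT.
      have [rj0|rj0] := eqVneq (r j) 0; first by move: dr1; rewrite rj0 oppr0.
      by move: rd0; rewrite pmulr_rge0// lt_def rj0 r0.
    have [Aj dE|/b'0//] := pselect (diagonalizable (A j)).
    by rewrite (@tri_diag_eq _ _ _ (r j) (b' j) F'u _ Aj)// F'A dE.

(* Necessity: the sign of [t] on the invariant cone *)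
move=> [K [Kproper KA]]; have [Kcone _ Kclosed _ Ksolid] := Kproper.
have [v Kv v0] := solid_off_axis 1 Fu Ksolid.
have FAw j w : (F *m (A j *m w)) 1 0 = d j * (F *m w) 1 0.
  by rewrite mulmxA FA -mulmxA mulmx2E !mxE /= mul0r add0r.
have [[k Ak]|alldiag] := pselect (exists k, ~ diagonalizable (A k)).
  have Ku j w : ~ diagonalizable (A j) -> K w -> K ((b j * (F *m w) 1 0) *: u).
    move=> Aj Kw; apply: (@shear_orbit_direction _ _ F (A j) _ _ (r j)) => //.
    by rewrite FA drE.
  right; split=> [j|i j Ai Aj].
    rewrite leNgt; apply/negP; rewrite detA => rd0.
    have dj0 : d j < 0 by rewrite ltNge; apply/negP => /(mulr_ge0 (r0 j)); rewrite leNgt rd0.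
    (* Comparing [v] with [A j *m v], whose second coordinate is [d j] times that of [v], gives
       [(b k t)^2 d j >= 0]. *)
    have := pointed_same_sign Kproper hu (Ku k v Ak Kv)
      (Ku k _ Ak (KA j _ Kv)).
    rewrite FAw [leRHS](_ : _ = (b k * (F *m v) 1 0) ^+ 2 * d j); last by ring.
    rewrite pmulr_rge0 ?leNgt ?dj0// exprn_even_gt0//= mulf_neq0//.
    exact: b0.
  have bij : 0 < b i * b j.
    have := pointed_same_sign Kproper hu (Ku i v Ai Kv) (Ku j v Aj Kv).
    rewrite [leRHS](_ : _ = (F *m v) 1 0 ^+ 2 * (b i * b j)); last by ring.
    rewrite pmulr_rge0 ?exprn_even_gt0// => bij.
    by rewrite lt_def bij mulf_neq0// b0.
  have posE l w : ~ diagonalizable (A l) ->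
      pos_associated (A l) u w <-> 0 < b l * (F *m w) 1 0.
    by move=> Al; apply: (pos_associatedE w Fu Fe); rewrite FA drE.
  have bEw w : 0 < b i * (F *m w) 1 0 <-> 0 < b j * (F *m w) 1 0.
    have -> : b i * (F *m w) 1 0 = b i * b j * ((F *m w) 1 0 / b j).
      by field; exact: b0.
    have -> : b j * (F *m w) 1 0 = b j ^+ 2 * ((F *m w) 1 0 / b j).
      by field; exact: b0.
    by rewrite (pmulr_rgt0 _ bij) (@pmulr_rgt0 _ (b j ^+ 2))// exprn_even_gt0//= b0.
  by apply/seteqP; split=> w /= /(posE _ _ _) bw; apply/posE => //; apply/bEw;
    apply: bw.
left; split=> [j|j k dj tj dk tk].
  by apply: contra_notP alldiag => Aj; exists j.
have [rj djE] := reflect j dj tj; have [rk dkE] := reflect k dk tk.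
(* The off-diagonal entry of the product, whose diagonal entries both equal [r j * r k]; [x = 0]
   means that [A j] and [A k] are proportional. *)
pose x := r j * b k - b j * r k.
have FAA : F *m (A j *m A k) = utri (r j * r k) x (r j * r k) *m F.
  rewrite mulmxA FA -mulmxA FA mulmxA mul_utri djE dkE mulrNN.
  by rewrite mulrN.
have AAu : A j *m A k *m u = (r j * r k) *: u.
  by rewrite -mulmxA hAu -scalemxAr hAu scalerA mulrC.
have KAA : mx_invariant (A j *m A k) K.
  by move=> w Kw; rewrite -mulmxA; apply/KA/KA.
have Ku w : K w -> K ((x * (F *m w) 1 0) *: u).
  move=> Kw; apply: shear_orbit_direction FAA AAu _ Kw => //.
  by rewrite mulr_ge0.
have x0 : x = 0.
  (* Since [A j] multiplies [t] by [- r j], pointedness yields [- r j (x t)^2 >= 0]. *)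
  have := pointed_same_sign Kproper hu (Ku v Kv) (Ku _ (KA j _ Kv)).
  rewrite FAw djE [leRHS](_ : _ = - (r j * (x * (F *m v) 1 0) ^+ 2)); last by ring.
  rewrite oppr_ge0 pmulr_rle0// => x20; apply/eqP.
  have /eqP : (x * (F *m v) 1 0) ^+ 2 = 0 by apply/eqP; rewrite eq_le x20 sqr_ge0.
  by rewrite expf_eq0 /= mulf_eq0 (negPf v0) orbF.
exists (r j / r k); apply: (can_inj (mulKmx Fu)).
rewrite -scalemxAr !FA scalemxAl; congr (_ *m _).
have rk0 : r k != 0 by rewrite gt_eqF.
have bE : b j = r j / r k * b k.
  have xE : b j = r j / r k * b k - x / r k by rewrite /x; field.
  by rewrite xE x0 mul0r subr0.
apply/matrixP=> i l; case: (ord2P i) => ->; case: (ord2P l) => ->;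
  rewrite !mxE /= ?mulr0 ?bE// ?djE ?dkE; field; exact: rk0.
Qed.
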